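(* Let $n\in\mathbb{N}$. Then $$S_nS_n\subset S_n,\qquad V_nV_n\subset S_n,\qquad V_nS_n\subset V_n,\qquad S_nV_n\subset V_n.$$
   Context: $S_n$ is the space of matrices $M\in\mathbb{R}^{n\times n}$ for which there is $w\in\mathbb{R}$ such that $\sum_{j=1}^nM_{i,j}=\sum_{j=1}^nM_{j,i}=nw$ for all $i\in\{1,\dots,n\}$. $V_n$ is the space of matrices $M\in\mathbb{R}^{n\times n}$ such that $M_{i,j}+M_{k,l}=M_{i,l}+M_{k,j}$ for all $i,j,k,l\in\{1,\dots,n\}$ and $\sum_{i,j=1}^nM_{i,j}=0$. For sets of matrices $X,Y$, $XY$ denotes the set of matrix products $xy$ with $x\in X$, $y\in Y$. *)

(* Defs.v *)
From mathcomp Require Import all_boot all_order all_algebra.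
From mathcomp Require Import classical_sets reals.

Set Implicit Arguments.
Unset Strict Implicit.
Unset Printing Implicit Defensive.

Import GRing.Theory.
Local Open Scope classical_set_scope.
Local Open Scope ring_scope.

Definition Sspace (R : realType) (n : nat) : set 'M[R]_n :=
  [set M | exists w : R, forall i : 'I_n,
     \sum_(j < n) M i j = n%:R * w /\ \sum_(j < n) M j i = n%:R * w].

Definition Vspace (R : realType) (n : nat) : set 'M[R]_n :=
  [set M | (forall i j k l : 'I_n, M i j + M k l = M i l + M k j) /\
     \sum_(i < n) \sum_(j < n) M i j = 0].

Definition mulmx_set (R : realType) (n : nat) (X Y : set 'M[R]_n) :
    set 'M[R]_n :=
  [set x *m y | x in X & y in Y].

Arguments Sspace : clear implicits.
Arguments Vspace : clear implicits.

(* Main.v *)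
Require Import Defs.
From mathcomp Require Import all_boot all_order all_algebra.
From mathcomp Require Import classical_sets reals.

(** Elements of [Vspace] are exactly the matrices [M i j = r i + c j] with
    [r] and [c] of sum zero. A product [A B] has row sums [A (B 1)] and column
    sums [(1 A) B], where [1] is the all-ones vector. For [A], [B] in [Sspace]
    these are constant; for [A], [B] in [Vspace] both are constantly [n] times
    the pairing of the column part of [A] with the row part of [B]. For mixed
    products the additive decomposition is read off directly; transposition
    preserves both spaces and exchanges the two cases. *)

Local Open Scope classical_set_scope.

Import GRing.Theory Num.Theory.
Local Open Scope ring_scope.

Section Products.
Variables (R : realType) (n : nat).
Implicit Types A B M : 'M[R]_n.

Lemma sum_row_mulmx A B i :
  \sum_k (A *m B) i k = \sum_j A i j * \sum_k B j k.
Proof.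
under eq_bigr do rewrite mxE.
by rewrite exchange_big; apply: eq_bigr => j _; rewrite mulr_sumr.
Qed.

Lemma sum_col_mulmx A B k :
  \sum_i (A *m B) i k = \sum_j (\sum_i A i j) * B j k.
Proof.
under eq_bigr do rewrite mxE.
by rewrite exchange_big; apply: eq_bigr => j _; rewrite mulr_suml.
Qed.

(** Averaging the four-entry identity over [k] and [l] removes [M k l], as the total is zero; what
    is left is row mean plus column mean. *)
Lemma Vspace_decomp M : Vspace R n M ->
  exists r c : 'I_n -> R, [/\ forall i j, M i j = r i + c j,
    \sum_i r i = 0 & \sum_j c j = 0].
Proof.
move=> [M4 M0].
exists (fun i => n%:R^-1 * \sum_j M i j), (fun j => n%:R^-1 * \sum_i M i j).
split; last 2 first.
- by rewrite -mulr_sumr M0 mulr0.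
- by rewrite -mulr_sumr exchange_big M0 mulr0.
(* The index [i] excludes [n = 0], so the means are genuine. *)
move=> i j; have n0 : n%:R != 0 :> R by rewrite pnatr_eq0; case: (n) i => [[]|].
apply: (mulfI n0); rewrite -mulrDr mulVKf //.
(* Sum [M i j + M k l = M i l + M k j] over [k] and [l]. *)
apply: (mulfI n0).
have : \sum_k \sum_l (M i j + M k l) = \sum_k \sum_l (M i l + M k j).
  by apply: eq_bigr => k _; apply: eq_bigr => l _; apply: M4.
under eq_bigr do rewrite big_split /=.
under [RHS]eq_bigr do rewrite big_split /=.
rewrite !big_split /= M0 addr0 !sumr_const !card_ord.
under [X in _ + X]eq_bigr do rewrite sumr_const card_ord.
by rewrite sumrMnl mulrDr !mulr_natl.
Qed.

Lemma Vspace_of_decomp M (r c : 'I_n -> R) :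
    (forall i j, M i j = r i + c j) -> \sum_i r i = 0 -> \sum_j c j = 0 ->
  Vspace R n M.
Proof.
move=> Mrc r0 c0; split=> [i j k l|].
  by rewrite !Mrc addrACA [RHS]addrACA [c l + _]addrC.
under eq_bigr do under eq_bigr do rewrite Mrc.
under eq_bigr do rewrite big_split /= c0 addr0 sumr_const.
by rewrite sumrMnl r0 mul0rn.
Qed.

Lemma Sspace_mul A B : Sspace R n A -> Sspace R n B -> Sspace R n (A *m B).
Proof.
(* Row and column sums of the product are [(n * u) * (n * v)]; one factor [n] belongs to the
   normalisation. *)
move=> [u Au] [v Bv]; exists (n%:R * u * v) => i; split.
  rewrite sum_row_mulmx; under eq_bigr do rewrite (Bv _).1.
  by rewrite -mulr_suml (Au i).1 mulrCA mulrA.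
rewrite sum_col_mulmx; under eq_bigr do rewrite (Au _).2.
by rewrite -mulr_sumr (Bv i).2 mulrCA mulrA.
Qed.

Lemma Vspace_mul A B : Vspace R n A -> Vspace R n B -> Sspace R n (A *m B).
Proof.
move=> /Vspace_decomp[r [c [Arc r0 c0]]] /Vspace_decomp[s [d [Bsd s0 d0]]].
(* Row [i] sums to [\sum_j (r i + c j) * (n * s j)], where the [r i] term dies because [s] sums to
   zero; in column sums the [d] term dies because [c] does. *)
exists (\sum_j c j * s j) => i; split.
  rewrite sum_row_mulmx mulr_sumr.
  under eq_bigr => j _.
    under eq_bigr do rewrite Bsd.
    rewrite big_split /= d0 addr0 sumr_const card_ord Arc mulrDl.
    rewrite -[s j *+ n]mulr_natl [c j * _]mulrCA.
    over.
  by rewrite big_split /= -!mulr_sumr s0 !mulr0 add0r.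
rewrite sum_col_mulmx mulr_sumr.
under eq_bigr => j _.
  under eq_bigr do rewrite Arc.
  rewrite big_split /= r0 add0r sumr_const card_ord Bsd mulrDr.
  rewrite -[c j *+ n]mulr_natl -!mulrA.
  over.
by rewrite big_split /= -!mulr_sumr -mulr_suml c0 mul0r mulr0 addr0.
Qed.

Lemma Vspace_mul_Sspace A B :
  Vspace R n A -> Sspace R n B -> Vspace R n (A *m B).
Proof.
move=> /Vspace_decomp[r [c [Arc r0 c0]]] [w Bw].
(* Expanding [A i j = r i + c j], the [r i] part meets a column sum of [B], which is [n * w] for
   every [k]. The [c] part has total zero because the row sums of [B] are constant. *)
apply: (@Vspace_of_decomp _ (fun i => r i * (n%:R * w))
                            (fun k => \sum_j c j * B j k)).
- move=> i k; rewrite mxE -(Bw k).2 mulr_sumr -big_split /=.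
  by apply: eq_bigr => j _; rewrite Arc mulrDl.
- by rewrite -mulr_suml r0 mul0r.
- rewrite exchange_big /=.
  under eq_bigr do rewrite -mulr_sumr (Bw _).1.
  by rewrite -mulr_suml c0 mul0r.
Qed.

Lemma Sspace_tr M : Sspace R n M -> Sspace R n M^T.
Proof.
move=> [w Mw]; exists w => i; have [Mr Mc] := Mw i.
by split; under eq_bigr do rewrite mxE.
Qed.

Lemma Vspace_tr M : Vspace R n M -> Vspace R n M^T.
Proof.
move=> /Vspace_decomp[r [c [Mrc r0 c0]]].
by apply: (@Vspace_of_decomp _ c r) => // i j; rewrite mxE Mrc addrC.
Qed.

Lemma Sspace_mul_Vspace A B :
  Sspace R n A -> Vspace R n B -> Vspace R n (A *m B).
Proof.
move=> SA VB; rewrite -[A *m B]trmxK trmx_mul; apply: Vspace_tr.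
by apply: Vspace_mul_Sspace; [apply: Vspace_tr | apply: Sspace_tr].
Qed.

End Products.

Local Close Scope ring_scope.

Theorem theorem9 (R : realType) (n : nat) :
  [/\ mulmx_set (Sspace R n) (Sspace R n) `<=` Sspace R n,
      mulmx_set (Vspace R n) (Vspace R n) `<=` Sspace R n,
      mulmx_set (Vspace R n) (Sspace R n) `<=` Vspace R n
    & mulmx_set (Sspace R n) (Vspace R n) `<=` Vspace R n].
Proof.
split=> _ [A HA [B HB <-]].
- exact: Sspace_mul.
- exact: Vspace_mul.
- exact: Vspace_mul_Sspace.
- exact: Sspace_mul_Vspace.
Qed.
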